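(* Let $\{\tau_b\}_{b\in\mathcal{B}}$ with weights $(p_b)_{b\in\mathcal{B}}$ be an affine iterated function system on $\mathbb{R}^d$ with no overlap, and let $\mu$ be its invariant measure. If $\mu$ admits a frame measure, then all the probabilities $p_b$, $b\in\mathcal{B}$, are equal.
   Context: Affine IFS: $R$ a real $d\times d$ expansive matrix (all eigenvalues of modulus $>1$), $\mathcal{B}=\{b_1,\dots,b_N\}\subset\mathbb{R}^d$, probability weights $p_{b}>0$ with $\sum_b p_{b}=1$, maps $\tau_{b}(x)=R^{-1}(x+b)$. The attractor $X$ is the unique nonempty compact set with $X=\bigcup_b\tau_{b}(X)$; the invariant measure $\mu$ is the unique Borel probability measure with $\mu(E)=\sum_b p_{b}\mu(\tau_{b}^{-1}(E))$ for all Borel $E$. No overlap: $\mu(\tau_{b}(X)\cap\tau_{b'}(X))=0$ for all $b\ne b'$. A Borel measure $\nu$ is a frame measure for $\mu$ if there are $A,B>0$ with $A\|f\|_{L^2(\mu)}^2\le \|\widehat{f\,d\mu}\|_{L^2(\nu)}^2\le B\|f\|_{L^2(\mu)}^2$ for all $f\in L^2(\mu)$, where $\widehat{f\,d\mu}(t)=\int f(x)e^{-2\pi i t\cdot x}\,d\mu(x)$. *)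

(* Defs.v *)
From HB Require Import structures.
From mathcomp Require Import all_boot all_order all_algebra.
From mathcomp Require Import all_classical all_reals all_analysis.
From mathcomp Require Import complex.
Import numFieldNormedType.Exports.
Set Implicit Arguments. Unset Strict Implicit. Unset Printing Implicit Defensive.
Import Order.TTheory GRing.Theory Num.Theory.
Local Open Scope classical_set_scope.
Local Open Scope ring_scope.

(* R^d is modelled by column vectors 'cV[R]_d; it carries its (product =
   Euclidean) topology, and [borelV R d] is the same carrier equipped with
   the Borel sigma-algebra generated by the open sets. *)
Definition borelV (R : realType) (d : nat) :=
  g_sigma_algebraType (@open 'cV[R]_d).

Definition dotv (R : realType) (d : nat) (t x : 'cV[R]_d) : R :=
  \sum_(i < d) t i ord0 * x i ord0.

Definition expansive (R : realType) (d : nat) (M : 'M[R]_d) : Prop :=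
  forall z : R[i], eigenvalue (map_mx (fun r : R => (r%:C)%C) M) z -> 1 < `|z|.

Definition ifs_map (R : realType) (d : nat) (M : 'M[R]_d) (b x : 'cV[R]_d)
  : 'cV[R]_d := invmx M *m (x + b).

(* A complex-valued function f = u + i v on R^d is identified with the pair
   (u, v) of its real and imaginary parts.  f belongs to L^2(mu) iff u and v
   are measurable and square integrable. *)
Definition L2c (R : realType) (d : nat) (mu : {measure set borelV R d -> \bar R})
  (u v : borelV R d -> R) : Prop :=
  [/\ measurable_fun setT u, measurable_fun setT v,
      (\int[mu]_x ((u x) ^+ 2)%:E < +oo)%E &
      (\int[mu]_x ((v x) ^+ 2)%:E < +oo)%E].

Definition L2c_normsq (R : realType) (d : nat)
  (mu : {measure set borelV R d -> \bar R}) (u v : borelV R d -> R) : \bar R :=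
  (\int[mu]_x ((u x) ^+ 2 + (v x) ^+ 2)%:E)%E.

(* Real and imaginary parts of  hat(f dmu)(t) = int f(x) e^{-2 pi i t.x} dmu(x):
   f(x) e^{-i th} = (u cos th + v sin th) + i (v cos th - u sin th). *)
Definition fourier_re (R : realType) (d : nat)
  (mu : {measure set borelV R d -> \bar R}) (u v : borelV R d -> R)
  (t : 'cV[R]_d) : R :=
  Rintegral mu setT (fun x : borelV R d =>
    u x * cos (2 * pi * dotv t x) + v x * sin (2 * pi * dotv t x)).

Definition fourier_im (R : realType) (d : nat)
  (mu : {measure set borelV R d -> \bar R}) (u v : borelV R d -> R)
  (t : 'cV[R]_d) : R :=
  Rintegral mu setT (fun x : borelV R d =>
    v x * cos (2 * pi * dotv t x) - u x * sin (2 * pi * dotv t x)).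

Definition fourier_abs2 (R : realType) (d : nat)
  (mu : {measure set borelV R d -> \bar R}) (u v : borelV R d -> R)
  (t : borelV R d) : R :=
  (fourier_re mu u v t) ^+ 2 + (fourier_im mu u v t) ^+ 2.

Definition frame_measure (R : realType) (d : nat)
  (mu nu : {measure set borelV R d -> \bar R}) : Prop :=
  exists A B : R, [/\ 0 < A, 0 < B &
    forall u v : borelV R d -> R, L2c mu u v ->
      ((A%:E * L2c_normsq mu u v <= \int[nu]_t (fourier_abs2 mu u v t)%:E) /\
       (\int[nu]_t (fourier_abs2 mu u v t)%:E <= B%:E * L2c_normsq mu u v))%E].

(* Main.v *)
(* Write T for the n-th iterate of tau_i and A = M^-1, so that T x = A^n x + c.
   Without overlap, mu restricted to T(X) is p_i^n times the image of mu|X under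
   T.  Hence the Fourier transform of p_i^-n 1_{T(X)} at t is
   e^{-2 pi i t.c} int_X e^{-2 pi i t.A^n x} dmu(x), whose modulus does not depend
   on i, whereas its squared L^2-norm is p_i^-n mu(X).  The frame inequalities
   then give p_i^-n <= C p_j^-n for all n, with C the ratio of the frame bounds,
   hence p_j <= p_i.
   This only needs mu(X) > 0: cylinder maps of large order send a ball of positive
   measure into an arbitrarily small neighbourhood of X, because A^n -> 0. *)

Require Import Defs.
From HB Require Import structures.
From mathcomp Require Import all_boot all_order all_algebra.
From mathcomp Require Import all_classical all_reals all_analysis.
From mathcomp Require Import measurable_realfun ring lra complex.
Import numFieldNormedType.Exports.
Import Order.TTheory GRing.Theory Num.Theory.
Local Open Scope classical_set_scope.
Local Open Scope ring_scope.

(** * Powers of the inverse of an expansive matrix *)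

Lemma contracting_recursion_cvg0 (R : realType) (q : R) (u y : R^nat) :
  0 <= q < 1 -> (forall n, 0 <= u n) ->
  (forall n, u n.+1 <= q * u n + y n) ->
  y n @[n --> \oo] --> 0 -> u n @[n --> \oo] --> 0.
Proof.
move=> /andP[q0 q1] u0 uS y0; apply/cvgrPdist_lt => e e0.
have q'0 : 0 < 1 - q by rewrite subr_gt0.
(* With this tolerance on [y], the affine map x -> q x + e/2 (1 - q) has the fixed point e/2, which
   is the additive term in [H]. *)
have e'0 : 0 < e / 2 * (1 - q) by rewrite mulr_gt0 ?divr_gt0.
have /cvgrPdist_lt/(_ _ e'0)[k _ ky] := y0.
have H m : u (k + m)%N <= q ^+ m * u k + e / 2.
  elim: m => [|m IH].
    by rewrite addn0 expr0 mul1r lerDl divr_ge0 // ltW.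
  rewrite addnS; apply: (le_trans (uS _)).
  have /ltW := ky (k + m)%N (leq_addr _ _).
  rewrite sub0r normrN => /(le_trans (ler_norm _)) ym.
  have : q * u (k + m)%N <= q * (q ^+ m * u k + e / 2) by rewrite ler_wpM2l.
  rewrite exprS; lra.
have /cvgrPdist_lt/(_ (e / 2)) : geometric (u k) q m @[m --> \oo] --> 0.
  by apply: cvg_geometric; rewrite ger0_norm.
case; first by rewrite divr_gt0.
move=> m0 _ m0P; exists (k + m0)%N => // n /= kn.
have [km mk] : (k <= n)%N /\ (m0 <= n - k)%N.
  by split; [exact: leq_trans (leq_addr _ _) kn | rewrite leq_subRL ?(leq_trans (leq_addr _ _) kn)].
rewrite sub0r normrN ger0_norm //.
have := H (n - k)%N; rewrite subnKC // => /le_lt_trans; apply.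
have := m0P _ mk; rewrite /= sub0r normrN => /(le_lt_trans (ler_norm _)).
by rewrite mulrC; lra.
Qed.

(** The modulus as an element of [R]: the norm on [R[i]] takes values in [R[i]], while the limits
    below are taken in [R]. *)
Local Notation normc := (@ComplexField.Normc.normc _).

Lemma normc_ge0 (R : rcfType) (x : R[i]) : 0 <= normc x.
Proof. by case: x => a c; exact: sqrtr_ge0. Qed.

Lemma normc_triangle (R : rcfType) (x y : R[i]) :
  normc (x + y) <= normc x + normc y.
Proof. by have := ler_normD x y; rewrite -lecR rmorphD. Qed.

(* By Cayley-Hamilton, prod (A - z) A^n = 0 over the eigenvalues z; the factors
   are removed one at a time, since (A - z) B A^n -> 0 with |z| < 1 is a
   contracting recursion for the entries of B A^n. *)
Lemma mx_expr_cvg0 (R : realType) (d : nat) (A : 'M[R[i]]_d.+1) :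
  (forall z, eigenvalue A z -> `|z| < 1) ->
  forall i j, normc ((A ^+ n) i j) @[n --> \oo] --> (0 : R).
Proof.
move=> Alt1.
have [r cpE] := closed_field_poly_normal (char_poly A).
have lt1 z : z \in r -> normc z < 1.
  move=> zr; have := Alt1 z; rewrite eigenvalue_root_char cpE.
  rewrite (monicP (char_poly_monic A)) scale1r root_prod_XsubC => /(_ zr).
  by rewrite -ltcR.
have : horner_mx A (\prod_(z <- r) ('X - z%:P)) = 0.
  by rewrite -[RHS](Cayley_Hamilton A) cpE (monicP (char_poly_monic A)) scale1r.
pose P B := forall i j, normc ((B * A ^+ n) i j) @[n --> \oo] --> (0 : R).
suff H (s : seq R[i]) : {subset s <= r} ->
    P (horner_mx A (\prod_(z <- s) ('X - z%:P))) -> P 1.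
  move=> cp0; suff P1 : P 1.
    by move=> i j; have := P1 i j; under eq_fun do rewrite mul1r.
  apply: (H r) => //; rewrite cp0 => i j.
  under eq_fun do rewrite mul0r mxE ComplexField.Normc.normc0.
  exact: cvg_cst.
elim: s => [|z s IH] sr; first by rewrite big_nil rmorph1.
rewrite big_cons => Pzs; apply: IH => [w ws|i j].
  by apply: sr; rewrite inE ws orbT.
move: Pzs; rewrite mulrC rmorphM /=; set B := horner_mx A _.
rewrite rmorphB /= horner_mx_X horner_mx_C => Pzs.
apply: (contracting_recursion_cvg0 _ (normc z) _ _ _ _ _ (Pzs i j)) => [|n|n].
- by rewrite lt1 ?sr ?mem_head // andbT normc_ge0.
- exact: normc_ge0.
- rewrite -ComplexField.Normc.normcM; apply: le_trans (normc_triangle _ _ _).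
  rewrite le_eqVlt; apply/orP; left; apply/eqP; congr normc.
  rewrite mulrBr mulrBl -mulrA -exprS.
  have -> : B * z%:M = z *: B by rewrite -mul_mx_scalar.
  have subZK (X Y : 'M[R[i]]_d.+1) : X i j = (X - z *: Y) i j + z * Y i j.
    by rewrite !mxE subrK.
  by rewrite -scalerAl addrC; exact: subZK.
Qed.

(** A singular [M] would have the eigenvalue 0, whose modulus is not above 1. *)
Lemma expansive_unitmx (R : realType) (d : nat) (M : 'M[R]_d) :
  expansive M -> M \in unitmx.
Proof.
move=> Mexp; rewrite -(map_unitmx (real_complex R)) -row_free_unit -kermx_eq0.
apply/negPn/negP => /rowV0Pn[v /sub_kermxP vM v0].
suff /Mexp : eigenvalue (map_mx (fun r : R => (r%:C)%C) M) 0 by rewrite normr0 ltr10.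
by apply/eigenvalueP; exists v; rewrite ?scale0r.
Qed.

(** Each eigenvalue of [invmx M] is the inverse of one of [M], hence lies in the open unit disc. *)
Lemma expansive_inv_expr_cvg0 (R : realType) (d : nat) (M : 'M[R]_d.+1) :
  expansive M ->
  forall i j, ((invmx M ^+ n) i j) @[n --> \oo] --> (0 : R).
Proof.
move=> Mexp i j; have Mu := expansive_unitmx _ _ _ Mexp.
pose f := real_complex R.
have : forall i j, normc ((map_mx f (invmx M) ^+ n) i j) @[n --> \oo] --> (0 : R).
  apply: mx_expr_cvg0 => z /eigenvalueP[v vE v0].
  have vM : v = z *: (v *m map_mx f M).
    by rewrite scalemxAl -vE -mulmxA -map_mxM mulVmx // map_mx1 mulmx1.
  have z0 : z != 0 by apply: contra_neq v0 => z0; rewrite vM z0 scale0r.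
  have /Mexp : eigenvalue (map_mx (fun r : R => (r%:C)%C) M) z^-1.
    by apply/eigenvalueP; exists v => //; rewrite {2}vM scalerA mulVf // scale1r.
  by rewrite normrV ?unitfE // invf_gt1 ?normr_gt0.
move=> /(_ i j)/cvgrPdist_lt H; apply/cvgrPdist_lt => e /H.
apply: filterS => n; rewrite -rmorphXn mxE !sub0r !normrN => /(le_lt_trans _); apply.
by rewrite (ger0_norm (normc_ge0 _ _)) /= expr0n /= addr0 sqrtr_sqr.
Qed.

(** * Continuity and Borel measurability on R^d *)

Lemma continuous_to_mx (R : numFieldType) (T : topologicalType) (m n : nat)
    (f : T -> 'M[R]_(m, n)) :
  (forall i j, continuous (fun x => f x i j)) -> continuous f.
Proof.
move=> cf x; apply/cvg_ballP => e e0.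
have : \forall y \near x, forall i j, ball (f x i j) e (f y i j).
  apply: filter_forall => i; apply: filter_forall => j.
  exact: cvg_ball (cf i j x) _ e0.
by apply: filterS => y fy; split.
Qed.

Lemma continuous_dotv (R : realType) (d : nat) (t : 'cV[R]_d) :
  continuous (dotv t).
Proof.
apply: continuous_big => [|i _ x]; first exact: add_continuous.
apply: (@cvgMr _ _ (nbhs x)); exact: coord_continuous.
Qed.

Lemma continuous_ifs_map (R : realType) (d : nat) (M : 'M[R]_d) (b : 'cV[R]_d) :
  continuous (ifs_map M b).
Proof.
apply: continuous_to_mx => i j.
have -> : (fun y => ifs_map M b y i j) =
    (fun y => \sum_k invmx M i k * (y + b) k j).
  by apply/funext => y; rewrite /ifs_map !mxE.
apply: continuous_big => [|k _ x]; first exact: add_continuous.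
under [X in continuous_at _ X]eq_fun do rewrite mxE.
apply: (@cvgMr _ _ (nbhs x)); apply: (@cvgD _ _ _ (nbhs x)); last exact: cvg_cst.
exact: coord_continuous.
Qed.

Lemma measurable_continuous_borelV (R : realType) (d d' : nat)
    (f : 'cV[R]_d -> 'cV[R]_d') :
  continuous f -> measurable_fun [set: borelV R d] (f : borelV R d -> borelV R d').
Proof.
move=> /continuousP cf.
apply: (@measurability _ _ (borelV R d) (borelV R d') setT f (@open 'cV[R]_d')) => //.
move=> _ [A oA <-]; rewrite setTI; apply: sub_sigma_algebra; exact: cf.
Qed.

Lemma measurable_continuous_borelV_real (R : realType) (d : nat) (f : 'cV[R]_d -> R) :
  continuous f -> measurable_fun [set: borelV R d] (f : borelV R d -> R).
Proof.
move=> /continuousP cf.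
apply: (measurability _ (@RGenOpens.measurableE R)) => _ [_ [a [c ->]] <-].
rewrite setTI; apply: sub_sigma_algebra; apply: cf; exact: interval_open.
Qed.

Lemma measurable_compact_borelV (R : realType) (d : nat) (X : set 'cV[R]_d) :
  compact X -> measurable (X : set (borelV R d)).
Proof.
move=> cX; rewrite -[X]setCK; apply: measurableC.
apply: sub_sigma_algebra; apply: closed_openC; apply: compact_closed => //.
Qed.

(** * Compositions of the affine maps *)

(** The maps share their linear part, so the translations cancel and only the length of the word
    matters. *)
Lemma foldr_ifs_mapB (R : realType) (d : nat) (M : 'M[R]_d.+1) (N : nat)
    (b : 'I_N -> 'cV[R]_d.+1) (s : seq 'I_N) (x y : 'cV[R]_d.+1) :
  foldr (fun i => ifs_map M (b i)) x s - foldr (fun i => ifs_map M (b i)) y s =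
  invmx M ^+ size s *m (x - y).
Proof.
elim: s => [|i s IH] /=; first by rewrite expr0 mul1mx.
by rewrite /ifs_map -mulmxBr opprD addrACA subrr addr0 IH mulmxA exprS.
Qed.

(** The translation, the only part that depends on [c], will become a unimodular factor of the
    Fourier transform. *)
Lemma iter_ifs_mapE (R : realType) (d : nat) (M : 'M[R]_d) (c : 'cV[R]_d)
    (n : nat) (x : 'cV[R]_d) :
  iter n (ifs_map M c) x = iter n (mulmx (invmx M)) x + iter n (ifs_map M c) 0.
Proof.
elim: n => [|n IH] /=; first by rewrite addr0.
by rewrite /ifs_map {1}IH -addrA mulmxDr.
Qed.

(** * Balls of positive mass and image measures *)

(** Otherwise the whole space would be a countable union of null balls. *)
Lemma exists_ball_measure_gt0 (R : realType) (d : nat) (mu : probability (borelV R d.+1) R) :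
  exists2 r : R, 0 < r & (0 < mu (ball (0 : 'cV[R]_d.+1)%R r))%E.
Proof.
apply: contrapT => Hr.
have mB r : measurable (ball (0 : 'cV[R]_d.+1) r : set (borelV R d.+1)).
  by apply: sub_sigma_algebra; exact: ball_open.
have : mu.-negligible (\bigcup_n (ball (0 : 'cV[R]_d.+1) n.+1%:R)).
  apply: negligible_bigcup => n; apply/negligibleP; first exact: mB.
  apply/eqP; rewrite eq_le measure_ge0 andbT leNgt; apply/negP => H.
  by apply: Hr; exists n.+1%:R.
have -> : \bigcup_n (ball (0 : 'cV[R]_d.+1) n.+1%:R) = setT.
  apply/seteqP; split => // x _; exists (Num.truncn `|x|) => //.
  rewrite mx_norm_ball /ball_ /= sub0r normrN.
  exact: truncnS_gt.
move=> /(negligibleP mu measurableT) m0; have : mu setT = 0%E by exact: m0.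
rewrite probability_setT => /eqP.
by rewrite onee_eq0.
Qed.

(** Change of variables, to be applied with both measures equal to [mu], [phi] an iterate of one map
    and [D] the image of the attractor. *)
Lemma ge0_integral_scaled_pushforward (d1 d2 : measure_display) (T1 : measurableType d1)
    (T2 : measurableType d2) (R : realType)
    (mu1 : {measure set T1 -> \bar R}) (mu2 : {measure set T2 -> \bar R})
    (phi : T1 -> T2) (k : R) (D : set T2) (f : T2 -> \bar R) :
  measurable_fun setT phi -> 0 <= k -> measurable D ->
  (forall F, measurable F -> F `<=` D -> mu2 F = (k%:E * mu1 (phi @^-1` F))%E) ->
  measurable_fun D f -> (forall x, D x -> (0 <= f x)%E) ->
  (\int[mu2]_(x in D) f x = k%:E * \int[mu1]_(x in phi @^-1` D) f (phi x))%E.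
Proof.
move=> mphi k0 mD mu2E mf f0.
rewrite (eq_measure_integral (mscale (NngNum k0) (pushforward mu1 phi))) => [|A mA AD].
  rewrite ge0_integral_mscale //= ge0_integral_pushforward // => y.
  by rewrite inE; exact: f0.
exact: mu2E.
Qed.

(** Follows from the nonnegative case; integrability makes the integrals of the positive and
    negative parts finite, so that [k] factors out of their difference. *)
Lemma Rintegral_scaled_pushforward (d1 d2 : measure_display) (T1 : measurableType d1)
    (T2 : measurableType d2) (R : realType)
    (mu1 : {measure set T1 -> \bar R}) (mu2 : {measure set T2 -> \bar R})
    (phi : T1 -> T2) (k : R) (D : set T2) (f : T2 -> R) :
  measurable_fun setT phi -> 0 <= k -> measurable D ->
  (forall F, measurable F -> F `<=` D -> mu2 F = (k%:E * mu1 (phi @^-1` F))%E) ->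
  measurable_fun setT f -> mu1.-integrable (phi @^-1` D) (EFin \o (f \o phi)) ->
  Rintegral mu2 D f = k * Rintegral mu1 (phi @^-1` D) (f \o phi).
Proof.
move=> mphi k0 mD mu2E mf intf.
have mEf : measurable_fun D (EFin \o f) by apply/measurable_EFinP; exact: measurable_funTS.
have mphiD : measurable (phi @^-1` D) by rewrite -[X in measurable X]setTI; exact: mphi.
have push := ge0_integral_scaled_pushforward _ _ _ _ _ mu1 mu2 phi k D _ mphi k0 mD mu2E.
have posE : (fun x => (EFin \o f)^\+ (phi x))%E = (EFin \o (f \o phi))^\+%E.
  by apply/funext => x; rewrite !funeposE.
have negE : (fun x => (EFin \o f)^\- (phi x))%E = (EFin \o (f \o phi))^\-%E.
  by apply/funext => x; rewrite !funenegE.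
rewrite /Rintegral integralE [in RHS]integralE.
rewrite push ?posE //; last exact: measurable_funepos.
rewrite push ?negE //; last exact: measurable_funeneg.
have posf := integrable_pos_fin_num mphiD intf.
have negf := integrable_neg_fin_num mphiD intf.
by rewrite -muleBr ?fin_num_adde_defr // fineM // fin_numB posf.
Qed.

(** * Null sets and cylinders of the invariant measure *)

Section invariant_measure.
Context (R : realType) (d : nat) (M : 'M[R]_d) (N : nat) (b : 'I_N -> 'cV[R]_d)
  (p : 'I_N -> R) (X : set 'cV[R]_d) (mu : probability (borelV R d) R).
Hypothesis Mu : M \in unitmx.
Hypothesis p_gt0 : forall i, 0 < p i.
Hypothesis p_sum1 : \sum_(i < N) p i = 1.
Hypothesis muE : forall E : set (borelV R d), measurable E ->
  mu E = (\sum_(i < N) (p i)%:E * mu (ifs_map M (b i) @^-1` E))%E.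

Local Notation tau i := (ifs_map M (b i)).

Lemma ifs_map_inj (c : 'cV[R]_d) : injective (ifs_map M c).
Proof.
move=> x y /(congr1 (mulmx M)); rewrite /ifs_map !mulmxA mulmxV // !mul1mx.
exact: addIr.
Qed.

Lemma measurable_ifs_map (c : 'cV[R]_d) :
  measurable_fun [set: borelV R d] (ifs_map M c : borelV R d -> borelV R d).
Proof. exact: measurable_continuous_borelV (@continuous_ifs_map _ _ _ _). Qed.

Lemma measurable_preimage_ifs (c : 'cV[R]_d) (E : set (borelV R d)) :
  measurable E -> measurable (ifs_map M c @^-1` E : set (borelV R d)).
Proof. by move=> mE; rewrite -[X in measurable X]setTI; exact: measurable_ifs_map. Qed.

(** A vanishing sum of nonnegative terms with positive weights has only vanishing terms. *)
Lemma null_preimage (E : set (borelV R d)) (i : 'I_N) : measurable E ->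
  mu E = 0%E -> mu (tau i @^-1` E) = 0%E.
Proof.
move=> mE; rewrite muE // => /eqP.
rewrite seq_psume_eq0 => [/allP/(_ i (mem_index_enum _))/=|j _].
  by rewrite mule_eq0 eqe gt_eqF //= => /eqP.
by apply: mule_ge0 => //; rewrite lee_fin ltW.
Qed.

(* mu(E) = sum_j p_j mu(tau_j^-1 E) is an average of terms that are all >= mu(E). *)
Lemma null_preimageD (E : set (borelV R d)) (i : 'I_N) : measurable E ->
  (forall j, E `<=` tau j @^-1` E) -> mu (tau i @^-1` E `\` E) = 0%E.
Proof.
move=> mE Esub.
have mP j := measurable_preimage_ifs (b j) _ mE.
have E0 : (\sum_(j < N) (p j)%:E * mu (tau j @^-1` E `\` E) = 0)%E.
  have : (mu E = \sum_(j < N) (p j)%:E * mu (tau j @^-1` E `\` E) + mu E)%E.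
    rewrite {1}muE //.
    rewrite -[X in (_ + X)%E]mul1e -p_sum1 -sumEFin ge0_sume_distrl; last first.
      by move=> j _; rewrite lee_fin ltW.
    rewrite -big_split /=; apply: eq_bigr => j _.
    rewrite -ge0_muleDr ?measure_ge0 //; congr (_ * _)%E.
    by rewrite (measureDI mu (mP j) mE) (setIidr (Esub j)).
  move/eqP; rewrite -sube_eq ?fin_num_measure //; last first.
    by apply: fin_num_adde_defl; rewrite fin_num_measure.
  by rewrite subee ?fin_num_measure // eq_sym => /eqP.
move/eqP: E0; rewrite seq_psume_eq0 => [/allP/(_ i (mem_index_enum _))/=|j _].
  by rewrite mule_eq0 eqe gt_eqF //= => /eqP.
by apply: mule_ge0 => //; rewrite lee_fin ltW.
Qed.

(** Unrolling invariance [n] times makes mu(F) a weighted average of the masses of its preimages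
    under words of length [n], all of which contain [K]. *)
Lemma le_mu_words (n : nat) (K F : set (borelV R d)) :
  measurable K -> measurable F ->
  (forall s : seq 'I_N, size s = n -> forall x, K x -> F (foldr (fun i => tau i) x s)) ->
  (mu K <= mu F)%E.
Proof.
move=> mK; elim: n F => [|n IH] F mF KF.
  by apply: le_measure; rewrite ?inE // => x; exact: KF [::] erefl x.
rewrite (muE _ mF) -[X in (X <= _)%E]mul1e -p_sum1 -sumEFin ge0_sume_distrl; last first.
  by move=> j _; rewrite lee_fin ltW.
apply: lee_sum => i _; apply: lee_pmul => //; first by rewrite lee_fin ltW.
apply: IH => [|s sn x Kx]; first exact: measurable_preimage_ifs.
by apply: (KF (i :: s)) => //=; rewrite sn.
Qed.

Hypothesis cptX : compact X.
Hypothesis XE : X = \bigcup_(i in [set: 'I_N]) (tau i @` X).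
Hypothesis no_overlap : forall i j : 'I_N, i != j ->
  mu (tau i @` X `&` tau j @` X) = 0%E.

Lemma measurable_attractor : measurable (X : set (borelV R d)).
Proof. exact: measurable_compact_borelV. Qed.

Lemma ifs_map_attractor i x : X x -> X (tau i x).
Proof. by move=> Xx; rewrite XE; exists i => //; exists x. Qed.

Lemma measurable_iter_ifs (c : 'cV[R]_d) n :
  measurable_fun [set: borelV R d] (iter n (ifs_map M c) : borelV R d -> borelV R d).
Proof.
elim: n => [|n IH]; first exact: measurable_id.
exact: measurableT_comp (measurable_ifs_map c) IH.
Qed.

Lemma compact_iter_ifs (c : 'cV[R]_d) n : compact (iter n (ifs_map M c) @` X).
Proof.
elim: n => [|n IH]; first by rewrite image_id.
rewrite (_ : iter n.+1 _ @` X = ifs_map M c @` (iter n (ifs_map M c) @` X)).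
  apply: continuous_compact => //; apply: continuous_subspaceT.
  exact: continuous_ifs_map.
by rewrite image_comp.
Qed.

(** For j != i the preimage of [F] under tau_j is null. Its points in [X] are sent into the overlap
    of the two pieces, which has null preimage. Its points outside [X] are sent into [X], so
    [null_preimageD] covers them; they must be treated since [mu] is not known to be carried by
    [X]. *)
Lemma mu_sub_piece i (F : set (borelV R d)) : measurable F ->
  F `<=` tau i @` X -> mu F = ((p i)%:E * mu (tau i @^-1` F))%E.
Proof.
move=> mF FX.
rewrite {1}muE // (bigD1 i) //= big1 ?adde0 // => j ji.
suff -> : mu (tau j @^-1` F) = 0%E by rewrite mule0.
have mX := measurable_attractor.
have mtX k : measurable (tau k @` X : set (borelV R d)).
  by apply: measurable_compact_borelV; exact: (compact_iter_ifs (b k) 1).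
apply/eqP; rewrite eq_le measure_ge0 andbT.
have ij : i != j by rewrite eq_sym.
have n1 := null_preimageD _ j mX (fun k => @ifs_map_attractor k).
have n2 := null_preimage _ j (measurableI _ _ (mtX i) (mtX j)) (no_overlap i j ij).
have : (mu ((tau j @^-1` X `\` X) `|` (tau j @^-1` (tau i @` X `&` tau j @` X))) <= 0)%E.
  apply: le_trans (measureU2 _ _ _) _.
  - by apply: measurableD => //; exact: measurable_preimage_ifs.
  - by apply: measurable_preimage_ifs; exact: measurableI.
  - by rewrite [X in (X + _ <= _)%E]n1 [X in (_ + X <= _)%E]n2 adde0.
apply: le_trans; apply: le_measure; rewrite ?inE.
- exact: measurable_preimage_ifs.
- apply: measurableU.
  + by apply: measurableD => //; exact: measurable_preimage_ifs.
  + by apply: measurable_preimage_ifs; exact: measurableI.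
- move=> x Fx; have [Xx|nXx] := pselect (X x).
    by right; split; [exact: FX|exists x].
  left; split => //.
  by have [y Xy /= <-] := FX _ Fx; exact: ifs_map_attractor.
Qed.

(** The outermost map is peeled off: by injectivity, the preimage of [F] under tau_i lies in the
    image of [X] under one iterate less. *)
Lemma mu_sub_iter_piece i n (F : set (borelV R d)) : measurable F ->
  F `<=` iter n (tau i) @` X ->
  mu F = ((p i ^+ n)%:E * mu (iter n (tau i) @^-1` F))%E.
Proof.
elim: n F => [|n IH] F mF FX; first by rewrite expr0 mul1e.
have FX1 : F `<=` tau i @` X.
  move=> x /FX [y Xy <-]; exists (iter n (tau i) y) => //.
  by elim: n {IH FX} => //= n; exact: ifs_map_attractor.
rewrite (mu_sub_piece i) // (IH (tau i @^-1` F)) ?muleA ?exprS ?EFinM //.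
  exact: measurable_preimage_ifs.
by move=> x /FX [y Xy /ifs_map_inj yx]; exists y.
Qed.

Lemma preimage_iter_piece i n : iter n (tau i) @^-1` (iter n (tau i) @` X) = X.
Proof.
apply/seteqP; split => [x [y Xy]|x Xx]; last by exists x.
by elim: n => [/= <- //|n IH /= /ifs_map_inj].
Qed.

(** * Fourier transforms on cylinders *)

(** The cylinder of the constant word [i] of length [n]. *)
Definition piece i n : set (borelV R d) := iter n (ifs_map M (b i)) @` X.

Lemma measurable_piece i n : measurable (piece i n).
Proof. by apply: measurable_compact_borelV; exact: compact_iter_ifs. Qed.

Lemma mu_piece i n : mu (piece i n) = ((p i ^+ n)%:E * mu X)%E.
Proof.
rewrite (mu_sub_iter_piece i n) ?preimage_iter_piece //.
exact: measurable_piece.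
Qed.

(* The factor p_i^-n makes the modulus of the Fourier transform independent of i,
   so that no rescaling of an integral over nu (whose integrand would have to be
   measurable) is needed. *)
Definition piece_fun i n : borelV R d -> R := (cst (p i ^- n)) \_ (piece i n).

Definition phase (t x : 'cV[R]_d) : R := 2 * pi * dotv t x.

Lemma phaseD t x y : phase t (x + y) = phase t x + phase t y.
Proof.
rewrite /phase -mulrDr; congr (_ * _); rewrite /dotv -big_split /=.
by apply: eq_bigr => i _; rewrite mxE mulrDr.
Qed.

Lemma continuous_phase t : continuous (phase t).
Proof. by move=> x; apply: (@cvgMr _ _ (nbhs x)); exact: continuous_dotv. Qed.

Lemma continuous_mulmx_iter n : continuous (iter n (mulmx (invmx M)) : 'cV[R]_d -> 'cV[R]_d).
Proof.
elim: n => [|n IH] x; first exact: cvg_id.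
rewrite (_ : iter n.+1 _ = ifs_map M 0 \o iter n (mulmx (invmx M))).
  by apply: continuous_comp; [exact: IH | exact: continuous_ifs_map].
by apply/funext => y; rewrite /= /ifs_map addr0.
Qed.

Lemma continuous_iter_ifs (c : 'cV[R]_d) n :
  continuous (iter n (ifs_map M c) : 'cV[R]_d -> 'cV[R]_d).
Proof.
elim: n => [|n IH] x; first exact: cvg_id.
by apply: continuous_comp; [exact: IH | exact: continuous_ifs_map].
Qed.

Lemma integrable_bounded_comp (D : set (borelV R d)) (g : R -> R) (f : 'cV[R]_d -> R) :
  measurable D -> continuous g -> (forall x, `|g x| <= 1) -> continuous f ->
  mu.-integrable D (EFin \o (g \o f)).
Proof.
move=> mD cg g1 cf; apply: measurable_bounded_integrable => //.
- by rewrite ltey_eq fin_num_measure.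
- apply: measurable_funTS; apply: measurable_continuous_borelV_real => x.
  by apply: continuous_comp; [exact: cf|exact: cg].
- exists 1; split => // r r1 x _ /=; exact: le_trans (g1 _) (ltW r1).
Qed.

(** Change of variables by the [n]-th iterate; [g] stands for both cosine and sine. The index [i]
    survives only in the factor and in the constant phase. *)
Lemma fourier_piece_integral i n t (g : R -> R) :
  continuous g -> (forall x, `|g x| <= 1) ->
  Rintegral mu (piece i n) (fun x => g (phase t x)) =
  p i ^+ n * Rintegral mu X (fun x => g (phase t (iter n (mulmx (invmx M)) x)
     + phase t (iter n (ifs_map M (b i)) 0))).
Proof.
move=> cg g1.
rewrite (Rintegral_scaled_pushforward _ _ _ _ _ mu mu (iter n (ifs_map M (b i))) (p i ^+ n)).
- rewrite preimage_iter_piece //; congr (_ * _); apply: eq_Rintegral => x _.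
  by rewrite /= iter_ifs_mapE phaseD.
- exact: measurable_iter_ifs.
- by rewrite exprn_ge0 // ltW.
- exact: measurable_piece.
- by move=> F mF FX; exact: mu_sub_iter_piece.
- apply: measurable_continuous_borelV_real => x.
  by apply: continuous_comp; [exact: continuous_phase|exact: cg].
- rewrite preimage_iter_piece //; apply: integrable_bounded_comp => //.
  + exact: measurable_attractor.
  + by move=> x; apply: continuous_comp; [exact: continuous_iter_ifs|exact: continuous_phase].
Qed.

(** With A = [invmx M], this is the real part of the integral over [X] of e^{-2 pi i t.A^n x}, and
    [attractor_sin] is the opposite of its imaginary part. *)
Definition attractor_cos n t : R :=
  Rintegral mu X (fun x => cos (phase t (iter n (mulmx (invmx M)) x))).

Definition attractor_sin n t : R :=
  Rintegral mu X (fun x => sin (phase t (iter n (mulmx (invmx M)) x))).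

Lemma integrable_attractor n t (g : R -> R) :
  continuous g -> (forall x, `|g x| <= 1) ->
  mu.-integrable X (EFin \o (fun x => g (phase t (iter n (mulmx (invmx M)) x)))).
Proof.
move=> cg g1; apply: (integrable_bounded_comp _ g (phase t \o iter n (mulmx (invmx M)))) => //.
  exact: measurable_attractor.
by move=> x; apply: continuous_comp; [exact: continuous_mulmx_iter|exact: continuous_phase].
Qed.

Lemma integral_piece_cos i n t (c := phase t (iter n (ifs_map M (b i)) 0)) :
  Rintegral mu (piece i n) (fun x => cos (phase t x)) =
  p i ^+ n * (cos c * attractor_cos n t - sin c * attractor_sin n t).
Proof.
have intC := integrable_attractor n t _ (@continuous_cos R) (fun x => cos_max x).
have intS := integrable_attractor n t _ (@continuous_sin R) (fun x => sin_max x).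
have mX := measurable_attractor.
rewrite (fourier_piece_integral _ _ _ _ (@continuous_cos R) (fun x => cos_max x)).
congr (_ * _); rewrite -/c -!RintegralZl // -RintegralB //.
- by apply: eq_Rintegral => x _; rewrite cosD mulrC [sin c * _]mulrC.
- exact: (integrableZl mX (cos c) intC).
- exact: (integrableZl mX (sin c) intS).
Qed.

Lemma integral_piece_sin i n t (c := phase t (iter n (ifs_map M (b i)) 0)) :
  Rintegral mu (piece i n) (fun x => sin (phase t x)) =
  p i ^+ n * (cos c * attractor_sin n t + sin c * attractor_cos n t).
Proof.
have intC := integrable_attractor n t _ (@continuous_cos R) (fun x => cos_max x).
have intS := integrable_attractor n t _ (@continuous_sin R) (fun x => sin_max x).
have mX := measurable_attractor.
rewrite (fourier_piece_integral _ _ _ _ (@continuous_sin R) (fun x => sin_max x)).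
congr (_ * _); rewrite -/c -!RintegralZl // -RintegralD //.
- by apply: eq_Rintegral => x _; rewrite sinD mulrC [sin c * _]mulrC.
- exact: (integrableZl mX (cos c) intS).
- exact: (integrableZl mX (sin c) intC).
Qed.

(** The real and imaginary parts come from [attractor_sin] and [attractor_cos] by a rotation of
    angle [c], which alone depends on [i]. The function is placed in the imaginary slot, which
    leaves the modulus unchanged. *)
Lemma fourier_abs2_piece i n t :
  fourier_abs2 mu (cst 0) (piece_fun i n) t =
  attractor_cos n t ^+ 2 + attractor_sin n t ^+ 2.
Proof.
have pn0 : p i ^+ n != 0 by rewrite expf_neq0 // gt_eqF.
have pieceE (g : R -> R) : continuous g -> (forall x, `|g x| <= 1) ->
    Rintegral mu setT (fun x => piece_fun i n x * g (phase t x)) =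
    p i ^- n * Rintegral mu (piece i n) (fun x => g (phase t x)).
  move=> cg g1; rewrite -RintegralZl; last 2 first.
  - exact: measurable_piece.
  - apply: integrable_bounded_comp => //; [exact: measurable_piece|exact: continuous_phase].
  rewrite [RHS]Rintegral_mkcond; apply: eq_Rintegral => x _.
  by rewrite /piece_fun !patchE; case: ifP => _; rewrite ?mul0r.
set c := phase t (iter n (ifs_map M (b i)) 0).
have reE : fourier_re mu (cst 0) (piece_fun i n) t =
    cos c * attractor_sin n t + sin c * attractor_cos n t.
  rewrite /fourier_re; under eq_Rintegral do rewrite /cst mul0r add0r.
  rewrite (pieceE _ (@continuous_sin R) (fun x => sin_max x)).
  by rewrite integral_piece_sin mulrA mulVf // mul1r.
have imE : fourier_im mu (cst 0) (piece_fun i n) t =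
    cos c * attractor_cos n t - sin c * attractor_sin n t.
  rewrite /fourier_im; under eq_Rintegral do rewrite /cst mul0r subr0.
  rewrite (pieceE _ (@continuous_cos R) (fun x => cos_max x)).
  by rewrite integral_piece_cos mulrA mulVf // mul1r.
rewrite /fourier_abs2 reE imE.
rewrite -[RHS]mul1r -(cos2Dsin2 c); ring.
Qed.

(** The value p_i^{-2n} is integrated over a set of mass p_i^n mu(X). *)
Lemma integral_piece_fun_sqr i n :
  (\int[mu]_x ((piece_fun i n x) ^+ 2)%:E = (p i ^- n)%:E * mu X)%E.
Proof.
transitivity (\int[mu]_(x in piece i n) ((p i ^- n) ^+ 2)%:E)%E.
  rewrite [RHS]integral_mkcond; apply: eq_integral => x _.
  by rewrite /piece_fun !patchE; case: ifP => _; rewrite ?expr0n.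
rewrite integral_cst; last exact: measurable_piece.
rewrite [X in (_ * X)%E](mu_piece i n) muleA -EFinM; congr (_%:E * _)%E.
by rewrite expr2 -mulrA mulVf ?mulr1 // expf_neq0 // gt_eqF.
Qed.

Lemma L2c_piece i n : L2c mu (cst 0) (piece_fun i n).
Proof.
split=> //.
- by apply/(measurable_restrictT _ (measurable_piece i n)); exact: measurable_cst.
- by under eq_integral do rewrite /cst expr0n; rewrite integral0.
- by rewrite integral_piece_fun_sqr -ge0_fin_numE ?fin_numM ?fin_num_measure //;
    [exact: measurable_attractor|rewrite mule_ge0 // lee_fin invr_ge0 exprn_ge0 // ltW].
Qed.

Lemma L2c_normsq_piece i n :
  L2c_normsq mu (cst 0) (piece_fun i n) = ((p i ^- n)%:E * mu X)%E.
Proof.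
rewrite /L2c_normsq -integral_piece_fun_sqr; apply: eq_integral => x _.
by rewrite /cst expr0n add0r.
Qed.

Lemma frame_bound_pieces (nu : {measure set borelV R d -> \bar R}) (A B : R) :
  (forall u v : borelV R d -> R, L2c mu u v ->
    ((A%:E * L2c_normsq mu u v <= \int[nu]_t (fourier_abs2 mu u v t)%:E) /\
     (\int[nu]_t (fourier_abs2 mu u v t)%:E <= B%:E * L2c_normsq mu u v))%E) ->
  (0 < mu X)%E ->
  forall i j n, A * p i ^- n <= B * p j ^- n.
Proof.
move=> frame muX i j n.
have [lo _] := frame _ _ (L2c_piece i n); have [_ up] := frame _ _ (L2c_piece j n).
have same_fourier : (\int[nu]_t (fourier_abs2 mu (cst 0) (piece_fun i n) t)%:E =
    \int[nu]_t (fourier_abs2 mu (cst 0) (piece_fun j n) t)%:E)%E.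
  by apply: eq_integral => t _; rewrite !fourier_abs2_piece.
rewrite same_fourier in lo; have := le_trans lo up.
(* Being positive and finite, mu(X) cancels from both sides. *)
have muXfin : mu X \is a fin_num by apply: fin_num_measure; exact: measurable_attractor.
by rewrite !L2c_normsq_piece !muleA -!EFinM lee_pmul2r // lee_fin.
Qed.
End invariant_measure.

(** * Positive mass of the attractor *)

(** Each neighbourhood [U k] has mass at least [c], and these decrease to the closed set [X];
    continuity from above gives mu(X) >= c. *)
Lemma measure_attractor_gt0 (R : realType) (d : nat) (M : 'M[R]_d.+1) (N : nat)
    (b : 'I_N -> 'cV[R]_d.+1) (p : 'I_N -> R) (X : set 'cV[R]_d.+1)
    (mu : probability (borelV R d.+1) R) :
  expansive M -> (forall i, 0 < p i) -> \sum_(i < N) p i = 1 ->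
  X !=set0 -> compact X ->
  X = \bigcup_(i in [set: 'I_N]) (ifs_map M (b i) @` X) ->
  (forall E : set (borelV R d.+1), measurable E ->
     mu E = (\sum_(i < N) (p i)%:E * mu (ifs_map M (b i) @^-1` E))%E) ->
  (0 < mu X)%E.
Proof.
move=> Mexp p0 p1 [x0 Xx0] cX XE muE.
have [r r0 mur] := exists_ball_measure_gt0 _ _ mu.
set c := mu _ in mur.
(* A strict bound for the coordinates of [x - x0] when [x] is in the ball of radius [r]; the added 1
   puts [x0] in an open ball around 0. *)
pose rho := r + (`|x0| + 1).
have rho0 : 0 < rho by rewrite addr_gt0 // ltr_wpDl.
pose U (k : nat) : set (borelV R d.+1) := \bigcup_(y in X) ball (y : 'cV[R]_d.+1) k.+1%:R^-1.
have mB r' : measurable (ball (0 : 'cV[R]_d.+1) r' : set (borelV R d.+1)).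
  by apply: sub_sigma_algebra; exact: ball_open.
have mU k : measurable (U k).
  by apply: sub_sigma_algebra; apply: bigcup_open => y _; exact: ball_open.
have words_attractor s : X (foldr (fun i => ifs_map M (b i)) x0 s).
  by elim: s => //= i s IH; rewrite XE; exists i => //; exists (foldr (fun i => ifs_map M (b i)) x0 s).
have cU k : (c <= mu (U k))%E.
  pose e : R := k.+1%:R^-1.
  have e0 : 0 < e by rewrite invr_gt0.
  (* Each of the [d.+1] terms in a coordinate of [invmx M ^+ n *m (x - x0)] is then below
     [dl * rho], and together these bounds add up to [e]. *)
  pose dl := e / (d.+1%:R * rho).
  have dl0 : 0 < dl by rewrite divr_gt0 // mulr_gt0.
  have [n nP] : exists n, forall i j, `|(invmx M ^+ n) i j| < dl.
    have : \forall n \near \oo, forall i j, `|(invmx M ^+ n) i j| < dl.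
      apply: filter_forall => i; apply: filter_forall => j.
      have /cvgrPdist_lt/(_ _ dl0) := expansive_inv_expr_cvg0 _ _ _ Mexp i j.
      by apply: filterS => n; rewrite sub0r normrN.
    by case=> n _ /(_ n (leqnn _)) nP; exists n.
  apply: (le_mu_words _ _ _ _ _ _ _ p0 p1 muE n) => // s sn x xr.
  (* The word sends [x0] to a point of [X], and [x] close to that point. *)
  exists (foldr (fun i => ifs_map M (b i)) x0 s); first exact: words_attractor.
  split => // i j; rewrite /ball /= distrC.
  have -> : foldr (fun i => ifs_map M (b i)) x s i j -
      foldr (fun i => ifs_map M (b i)) x0 s i j =
      (invmx M ^+ n *m (x - x0)) i j.
    by rewrite -sn -(foldr_ifs_mapB _ _ M _ b s x x0) !mxE.
  rewrite mxE; apply: (le_lt_trans (ler_norm_sum _ _ _)).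
  have -> : k.+1%:R^-1 = \sum_(l < d.+1) dl * rho.
    have divK (a q : R) : a != 0 -> q != 0 -> e = a * (e / (a * q) * q).
      by move=> a0 q0; field; rewrite a0 q0.
    by rewrite sumr_const card_ord -[RHS]mulr_natl -divK ?pnatr_eq0 ?gt_eqF.
  apply: ltr_sum => [|l _]; first by apply/hasP; exists ord0; rewrite ?mem_index_enum.
  rewrite normrM; apply: ltr_pM => //.
  rewrite (ord1 j) !mxE; apply: (le_lt_trans (ler_normB _ _)); apply: ltrD.
    by case: xr => _ /(_ l ord0); rewrite /ball /= mxE sub0r normrN.
  have : ball (0 : 'cV[R]_d.+1) (`|x0| + 1) x0.
    by rewrite mx_norm_ball /ball_ /= sub0r normrN ltrDl.
  by case=> _ /(_ l ord0); rewrite /ball /= mxE sub0r normrN.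
have -> : mu X = mu (\bigcap_k U k).
  congr (mu _); apply/seteqP; split => [x Xx k _|x xU].
    by exists x => //; exact: ballxx.
  have clX : closed X by exact: compact_closed.
  apply: clX => B /nbhs_ballP[e /= e0 eB].
  (* The index is chosen so that the radius of the balls in [U k] is at most [e]. *)
  have [y Xy yx] := xU (Num.truncn e^-1) I.
  exists y; split => //; apply: eB; apply/ball_sym; apply: le_ball yx.
  by rewrite invf_ple ?posrE // ltW // truncnS_gt.
apply: (lt_le_trans mur).
have mu_lim : mu (U k) @[k --> \oo] --> mu (\bigcap_k U k).
  apply: nonincreasing_cvg_mu => //.
  - by rewrite ltey_eq fin_num_measure.
  - exact: bigcapT_measurable.
  - move=> m n mn; apply/subsetPset => x [y Xy yx]; exists y => //.
    by apply: le_ball yx; rewrite lef_pV2 ?posrE // ler_nat.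
rewrite -(cvg_lim _ mu_lim) //; apply: lime_ge; first exact: cvgP mu_lim.
exact: nearW.
Qed.

(** * Comparison of the probabilities *)

(** If x > y, Bernoulli's inequality makes the powers of x/y exceed any [C]. *)
Lemma le_of_geometric_bound (R : realType) (x y C : R) :
  0 < x -> 0 < y -> (forall n, (x / y) ^+ n <= C) -> x <= y.
Proof.
move=> x0 y0 xyC; rewrite leNgt; apply/negP => yx.
have q1 : 0 < x / y - 1 by rewrite subr_gt0 ltr_pdivlMr // mul1r.
have bern n : 1 + (x / y - 1) *+ n <= (x / y) ^+ n.
  elim: n => [|n IH]; first by rewrite mulr0n addr0 expr0.
  have h : 0 <= (x / y - 1) *+ n by rewrite mulrn_wge0 // ltW.
  rewrite exprS mulrSr.
  have : (x / y) * (1 + (x / y - 1) *+ n) <= (x / y) * (x / y) ^+ n.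
    by rewrite ler_wpM2l // divr_ge0 // ltW.
  apply: le_trans; move: h; set s := _ *+ n; nra.
set n := (Num.truncn (C / (x / y - 1))).+1.
have := le_trans (bern n) (xyC n); rewrite -mulr_natr.
have : C / (x / y - 1) < n%:R by exact: truncnS_gt.
rewrite ltr_pdivrMr //; lra.
Qed.

Theorem theorem3p4 (R : realType) (d : nat) (M : 'M[R]_d) (N : nat)
  (b : 'I_N -> 'cV[R]_d) (p : 'I_N -> R)
  (X : set 'cV[R]_d) (mu : probability (borelV R d) R) :
  expansive M ->
  injective b ->
  (forall i, 0 < p i) ->
  \sum_(i < N) p i = 1 ->
  (* X is the attractor *)
  X !=set0 -> compact X ->
  X = \bigcup_(i in [set: 'I_N]) (ifs_map M (b i) @` X) ->
  (* mu is the invariant measure *)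
  (forall E : set (borelV R d), measurable E ->
     mu E = (\sum_(i < N) (p i)%:E * mu (ifs_map M (b i) @^-1` E))%E) ->
  (* no overlap *)
  (forall i j : 'I_N, i != j ->
     mu (ifs_map M (b i) @` X `&` ifs_map M (b j) @` X) = 0%E) ->
  (* mu admits a frame measure *)
  (exists nu : {measure set borelV R d -> \bar R}, frame_measure mu nu) ->
  forall i j : 'I_N, p i = p j.
Proof.
move=> Mexp binj p0 p1 Xn0 cX XE muE ovl [nu [A [B [A0 B0 frame]]]].
(* In dimension 0 the space is a single point, so injectivity of [b] identifies all indices. *)
case: d => [|d] in M b X mu Mexp binj Xn0 cX XE muE ovl nu frame *.
  by move=> i j; congr p; apply: binj; apply/matrixP => -[].
have muX := measure_attractor_gt0 _ _ _ _ _ _ _ _ Mexp p0 p1 Xn0 cX XE muE.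
have Mu := expansive_unitmx _ _ _ Mexp.
suff le_p i j : p i <= p j by move=> i j; apply/eqP; rewrite eq_le !le_p.
apply: (le_of_geometric_bound _ _ _ (B / A)) => // n.
(* Taken with [j] in the lower bound and [i] in the upper one: A p_j^-n <= B p_i^-n rearranges to
   (p_i/p_j)^n <= B/A. *)
have := frame_bound_pieces _ _ _ _ _ _ _ _ Mu p0 p1 muE cX XE ovl nu _ _ frame muX j i n.
have pn0 : 0 < p i ^+ n by exact: exprn_gt0.
rewrite -(ler_pM2r pn0) divfK ?gt_eqF // expr_div_n ler_pdivlMr // => le_AB.
by apply: le_trans le_AB; rewrite [leLHS]mulrC mulrA mulrAC.
Qed.
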